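(* Let $w\in F$ be semipositive (without loss of generality, suppose it contains no $a^{-1}$). If $r$ is rational, so is $R(w,r,s)$. Moreover, the denominator of $R(w,r,s)$ is no bigger than the denominator of $r$.
   Context: $F$ is the free group on two generators $a,b$. A word $w\in F$ is semipositive if it either contains no $a^{-1}$ or contains no $b^{-1}$. $\mathrm{Homeo}^+(S^1)^\sim$ denotes the group of increasing homeomorphisms of $\mathbb{R}$ commuting with $x\mapsto x+1$ (lifts of orientation-preserving homeomorphisms of $S^1=\mathbb{R}/\mathbb{Z}$), and $\mathrm{rot}^\sim(\varphi)=\lim_{n\to\infty}(\varphi^n(x)-x)/n\in\mathbb{R}$ is the real-valued Poincaré rotation number. For $w\in F$ and $r,s\in\mathbb{R}$, $R(w,r,s)$ denotes the supremum of $\mathrm{rot}^\sim(\rho(w))$ over all homomorphisms $\rho:F\to \mathrm{Homeo}^+(S^1)^\sim$ with $\mathrm{rot}^\sim(\rho(a))=r$ and $\mathrm{rot}^\sim(\rho(b))=s$.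
   Formalization: The formal theorem assumes in addition that w is trivial or contains the letter a, excluding exactly w = b^n (n ≠ 0), where the claim fails: R(b^n,r,s) = ns for every r, so w = b, r = 0, s = √2 gives an irrational value. *)

(* Defs.v *)
From HB Require Import structures.
From mathcomp Require Import all_boot all_order all_algebra.
From mathcomp Require Import all_classical all_reals all_analysis.
Import Order.TTheory GRing.Theory Num.Theory.
Import numFieldNormedType.Exports.

Set Implicit Arguments.
Unset Strict Implicit.
Unset Printing Implicit Defensive.

Local Open Scope classical_set_scope.
Local Open Scope ring_scope.

(* A letter (g, e) is the generator a (g = false) or b (g = true), inverted   *)
(* when e = true.                                                             *)
Definition letter : Type := (bool * bool)%type.
HB.instance Definition _ := Finite.on letter.

Definition letter_a : letter := (false, false).
Definition letter_aV : letter := (false, true).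
Definition letter_b : letter := (true, false).
Definition letter_bV : letter := (true, true).

Definition letter_inv (x : letter) : letter := (x.1, ~~ x.2).

Definition reduced (s : seq letter) : bool :=
  sorted (fun x y => y != letter_inv x) s.

Definition push (x : letter) (s : seq letter) : seq letter :=
  if s is y :: s' then if y == letter_inv x then s' else x :: s
  else [:: x].

Definition reduce (s : seq letter) : seq letter := foldr push [::] s.

Lemma letter_invK : involutive letter_inv.
Proof. by case=> g e; rewrite /letter_inv /= negbK. Qed.

Lemma reduced_push x s : reduced s -> reduced (push x s).
Proof.
case: s => [|y s] //= ys; case: ifPn => [_|yx].
  by case: s ys => //= z s /andP[].
by rewrite /reduced /= yx.
Qed.

Lemma reduced_foldr s t : reduced t -> reduced (foldr push t s).
Proof. by move=> rt; elim: s => //= x s; exact: reduced_push. Qed.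

Lemma reduced_reduce s : reduced (reduce s).
Proof. exact: reduced_foldr. Qed.

Lemma pushK x s : reduced s -> push (letter_inv x) (push x s) = s.
Proof.
case: s => [|y s] /=; first by rewrite letter_invK eqxx.
case: ifPn => [/eqP-> |_ _].
  case: s => [|z s] //= /andP[]; rewrite letter_invK => zx _.
  by rewrite (negbTE zx).
by rewrite /push letter_invK eqxx.
Qed.

Lemma reduce_id s : reduced s -> reduce s = s.
Proof.
elim: s => //= x s IHs xs; rewrite IHs; last by case: s {IHs} xs => //= ? ? /andP[].
by case: s xs {IHs} => //= y s /andP[/negbTE ->].
Qed.

Lemma foldr_push x s t : reduced t ->
  foldr push t (push x s) = push x (foldr push t s).
Proof.
move=> rt; case: s => [|y s] //=; case: ifPn => [/eqP-> |//].
by rewrite -[X in _ = push X _](letter_invK x) pushK// reduced_foldr.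
Qed.

Lemma foldr_reduce s t : reduced t -> foldr push t (reduce s) = foldr push t s.
Proof. by move=> rt; elim: s => //= x s <-; rewrite foldr_push. Qed.

Record free2 := Free2 { word :> seq letter; _ : reduced word }.

HB.instance Definition _ := [isSub for word].
HB.instance Definition _ := [Choice of free2 by <:].

Definition free2_one : free2 := @Free2 [::] isT.
Definition free2_mul (u v : free2) : free2 :=
  Free2 (reduced_reduce (word u ++ word v)).
Definition free2_inv (u : free2) : free2 :=
  Free2 (reduced_reduce (rev (map letter_inv (word u)))).

Lemma reduced_word (u : free2) : reduced u.
Proof. by case: u. Qed.

Lemma free2_inj : injective word.
Proof. exact: val_inj. Qed.

Lemma free2_mulE u v : word (free2_mul u v) = foldr push v u.
Proof. by rewrite /= /reduce foldr_cat -/(reduce v) reduce_id ?reduced_word. Qed.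

Lemma free2_mulA : associative free2_mul.
Proof.
move=> u v w; apply: free2_inj; rewrite !free2_mulE.
by rewrite -[X in _ = foldr _ _ X]free2_mulE foldr_reduce ?reduced_word// foldr_cat.
Qed.

Lemma free2_mul1 : left_id free2_one free2_mul.
Proof. by move=> u; apply: free2_inj; rewrite free2_mulE. Qed.

Lemma free2_mulr1 : right_id free2_one free2_mul.
Proof.
move=> u; apply: free2_inj; rewrite free2_mulE.
exact/reduce_id/reduced_word.
Qed.

Lemma free2_mulV : left_inverse free2_one free2_inv free2_mul.
Proof.
move=> u; apply: free2_inj; rewrite free2_mulE foldr_reduce ?reduced_word//.
elim: (word u) => //= x s IHs.
by rewrite rev_cons foldr_rcons /= letter_invK eqxx.
Qed.

Lemma foldr_pushV s t : reduced t ->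
  foldr push (foldr push t (rev (map letter_inv s))) s = t.
Proof.
elim: s t => //= x s IHs t rt; rewrite rev_cons foldr_rcons IHs.
  by rewrite -[X in push X _]letter_invK pushK.
exact: reduced_push.
Qed.

Lemma free2_mulrV : right_inverse free2_one free2_inv free2_mul.
Proof. by move=> u; apply: free2_inj; rewrite free2_mulE foldr_pushV. Qed.

HB.instance Definition _ := isGroup.Build free2
  free2_mulA free2_mul1 free2_mulr1 free2_mulV free2_mulrV.

Definition fa : free2 := @Free2 [:: letter_a] isT.
Definition fb : free2 := @Free2 [:: letter_b] isT.

Definition semipositive (w : free2) : bool :=
  (letter_aV \notin word w) || (letter_bV \notin word w).

(* Homeo^+(S^1)^~; the inverse homeomorphism is part of the data, but is      *)
(* determined by the map.                                                     *)
Record lift_homeo (R : realType) := LiftHomeo {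
  lh_fun :> R -> R;
  lh_inv : R -> R;
  lh_funK : cancel lh_fun lh_inv;
  lh_invK : cancel lh_inv lh_fun;
  lh_cont : continuous lh_fun;
  lh_inv_cont : continuous lh_inv;
  lh_incr : {homo lh_fun : x y / x < y};
  lh_periodic : forall x, lh_fun (x + 1) = lh_fun x + 1
}.

Section LiftHomeoGroup.
Variable R : realType.
Implicit Types f g h : lift_homeo R.

HB.instance Definition _ := gen_eqMixin (lift_homeo R).
HB.instance Definition _ := gen_choiceMixin (lift_homeo R).

Lemma lift_homeoP f g : (f : R -> R) =1 g -> f = g.
Proof.
case: f g => f f' fK f'K cf cf' incf pf [g g' gK g'K cg cg' incg pg] /= /funext fg.
subst g; have fg' : f' = g' by apply/funext => x; rewrite -[in LHS](g'K x) fK.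
by subst g'; congr LiftHomeo; exact: Prop_irrelevance.
Qed.

Definition lh_one : lift_homeo R.
Proof.
by refine (@LiftHomeo R id id _ _ _ _ _ _) => //= x; exact: cvg_id.
Defined.

Definition lh_mul f g : lift_homeo R.
Proof.
refine (@LiftHomeo R (f \o g) (lh_inv g \o lh_inv f) _ _ _ _ _ _).
- exact: can_comp (@lh_funK _ f) (@lh_funK _ g).
- exact: can_comp (@lh_invK _ g) (@lh_invK _ f).
- by move=> x; apply: continuous_comp; exact: lh_cont.
- by move=> x; apply: continuous_comp; exact: lh_inv_cont.
- by move=> x y xy /=; do 2 apply: lh_incr.
- by move=> x /=; rewrite !lh_periodic.
Defined.

Definition lh_V f : lift_homeo R.
Proof.
refine (@LiftHomeo R (lh_inv f) f (@lh_invK _ f) (@lh_funK _ f)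
  (@lh_inv_cont _ f) (@lh_cont _ f) _ _).
- move=> x y xy; rewrite ltNge; apply/negP; rewrite le_eqVlt => /orP[/eqP yx|].
    by move: xy; rewrite -(lh_invK f x) -yx lh_invK ltxx.
  by move=> /(@lh_incr _ f); rewrite !lh_invK => /(lt_trans xy); rewrite ltxx.
- by move=> x; apply: (can_inj (@lh_funK _ f)); rewrite lh_periodic !lh_invK.
Defined.

Lemma lh_mulA : associative lh_mul.
Proof. by move=> f g h; exact: lift_homeoP. Qed.

Lemma lh_mul1 : left_id lh_one lh_mul.
Proof. by move=> f; exact: lift_homeoP. Qed.

Lemma lh_mulr1 : right_id lh_one lh_mul.
Proof. by move=> f; exact: lift_homeoP. Qed.

Lemma lh_mulV : left_inverse lh_one lh_V lh_mul.
Proof. by move=> f; apply: lift_homeoP => x /=; rewrite lh_funK. Qed.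

Lemma lh_mulrV : right_inverse lh_one lh_V lh_mul.
Proof. by move=> f; apply: lift_homeoP => x /=; rewrite lh_invK. Qed.

HB.instance Definition _ := isGroup.Build (lift_homeo R)
  lh_mulA lh_mul1 lh_mulr1 lh_mulV lh_mulrV.

End LiftHomeoGroup.

(* The limit of (f^n(x) - x) / n exists and does not depend on x; x = 0 here. *)
Definition rot (R : realType) (f : lift_homeo R) : R :=
  limn (fun n => ((f ^+ n)%g 0 - 0) / n%:R).

Definition max_rot (R : realType) (w : free2) (r s : R) : R :=
  sup [set rot (rho w) | rho in
    [set rho : {multiplicative free2 -> lift_homeo R} |
      rot (rho fa) = r /\ rot (rho fb) = s]].

(* Main.v *)
Require Import Defs.
From HB Require Import structures.
From mathcomp Require Import all_boot all_order all_algebra.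
From mathcomp Require Import all_classical all_reals all_analysis.
From mathcomp Require Import zify ring lra.
Import Order.TTheory GRing.Theory Num.Theory.
Import numFieldNormedType.Exports.

(* Let f = rho(a) have rotation number p/d. It has a periodic orbit, which can
   be listed increasingly as (X_i), i in Z, with X_{i+d} = X_i + 1 and
   f(X_i) = X_{i+p}. Hence f is dominated by the step function A sending
   (X_{i-1}, X_i] to X_{i+p}. Replace a by A and keep b: the resulting monotone
   map W takes its values after each A among the X_i, which are d points modulo
   1, so W^n(y) = y + t for some y, t and 1 <= n <= d, and rot(rho(w)) <= t/n by
   domination. Conversely, let phi be a homeomorphism fixing exactly the X_i and
   pushing all other points to the right. Then phi^k f still has rotation number
   p/d and increases to A off the orbit; as A is constant to the left of each
   point, there is e > 0 such that, for k large, the n-th iterate of the word in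
   phi^k f and b sends y - e to at least y + t - e, so that its rotation number
   is exactly t/n.
   The rotation numbers are bounded and dominated by attained ones of
   denominator at most d, so the supremum is one of them. *)

Set Implicit Arguments.
Unset Strict Implicit.
Unset Printing Implicit Defensive.

Local Open Scope ring_scope.

(* Not the rotation of sequences from [seq]. *)
Local Notation rot := Defs.rot.

(** * Displacement estimates and rotation numbers of lifts *)

Section LiftHomeo.
Variable R : realType.
Implicit Types (f g h : lift_homeo R) (x y : R) (n m : nat) (z : int).

Lemma lh_lt f : {mono f : x y / x < y}.
Proof. exact/leW_mono/le_mono/lh_incr. Qed.

Lemma lh_le f : {mono f : x y / x <= y}.
Proof. exact/le_mono/lh_incr. Qed.

Lemma lh_mulE f g x : (f * g)%g x = f (g x).
Proof. by []. Qed.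

Lemma lh_VE f x : (f^-1)%g x = lh_inv f x.
Proof. by []. Qed.

Lemma lh_expE f n x : (f ^+ n)%g x = iter n f x.
Proof. by elim: n => //= n IH; rewrite expgS lh_mulE IH. Qed.

Lemma lh_addn f x n : f (x + n%:R) = f x + n%:R.
Proof.
elim: n => [|n IH]; first by rewrite !addr0.
by rewrite -natr1 addrA lh_periodic IH addrA.
Qed.

Lemma lh_addz f x z : f (x + z%:~R) = f x + z%:~R.
Proof.
case: z => n; first exact: lh_addn.
rewrite NegzE mulrNz; apply/(addIr n.+1%:R).
by rewrite -lh_addn !subrK.
Qed.

Lemma iter_addz f n x z : iter n f (x + z%:~R) = iter n f x + z%:~R.
Proof. by rewrite -!lh_expE lh_addz. Qed.

Lemma iter_lh_le f n : {mono iter n f : x y / x <= y}.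
Proof. by move=> x y; rewrite -!lh_expE lh_le. Qed.

Lemma iter_shift_le f n k x z : iter n f x <= x + z%:~R ->
  iter (k * n) f x <= x + k%:R * z%:~R.
Proof.
move=> fx; elim: k => [|k IH]; first by rewrite mul0n mul0r addr0.
rewrite mulSnr iterD; apply: (@le_trans _ _ (iter (k * n) f (x + z%:~R))).
  by rewrite iter_lh_le.
by rewrite iter_addz -natr1 mulrDl mul1r addrA lerD2r.
Qed.

Lemma iter_shift_ge f n k x z : x + z%:~R <= iter n f x ->
  x + k%:R * z%:~R <= iter (k * n) f x.
Proof.
move=> fx; elim: k => [|k IH]; first by rewrite mul0n mul0r addr0.
rewrite mulSnr iterD; apply: (@le_trans _ _ (iter (k * n) f (x + z%:~R))); last first.
  by rewrite iter_lh_le.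
by rewrite iter_addz -natr1 mulrDl mul1r addrA lerD2r.
Qed.

(** The integer part of [y] passes through [f], and monotonicity bounds the effect of the fractional
    part by 1. *)
Lemma lh_disp f y : `|f y - f 0 - y| <= 1.
Proof.
have /andP[fl fu] := floor_itv y.
have : f (0 + (Num.floor y)%:~R) <= f y by rewrite lh_le add0r.
have : f y <= f (0 + (Num.floor y + 1)%:~R) by rewrite lh_le add0r ltW.
rewrite !lh_addz; move: fl fu; rewrite !intrD ler_norml.
by move=> ? ? ? ?; apply/andP; split; lra.
Qed.

Lemma iter_disp f n y : `|iter n f y - iter n f 0 - y| <= 1.
Proof. by have := lh_disp (f ^+ n)%g y; rewrite !lh_expE. Qed.

(** Each block of [n] iterations displaces any point by [iter n f 0] up to an error of 1. *)
Lemma iter_mul_bounds f n k :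
  k%:R * (iter n f 0 - 1) <= iter (k * n) f 0 <= k%:R * (iter n f 0 + 1).
Proof.
elim: k => [|k /andP[IH1 IH2]]; first by rewrite mul0n !mul0r lexx.
have := iter_disp f n (iter (k * n) f 0).
rewrite -iterD -mulSn ler_norml -natr1 !mulrDl => /andP[? ?].
by apply/andP; split; lra.
Qed.

(* The values [(f^n 0 - 1) / n] all lie below the values [(f^m 0 + 1) / m], and
   the rotation number is the cut between them. *)
Lemma rot_bound f n : `|iter n f 0 - n%:R * rot f| <= 1.
Proof.
pose a k := iter k f 0.
pose S := [set (a k.+1 - 1) / k.+1%:R | k in [set: nat]]%classic.
have cut k m : (a k.+1 - 1) / k.+1%:R <= (a m.+1 + 1) / m.+1%:R.
  rewrite ler_pdivrMr ?ltr0Sn// mulrAC ler_pdivlMr ?ltr0Sn//.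
  have /andP[h1 _] := iter_mul_bounds f k.+1 m.+1.
  have /andP[_ h2] := iter_mul_bounds f m.+1 k.+1.
  by rewrite mulnC in h2; have := le_trans h1 h2; rewrite /a mulrC [in leRHS]mulrC.
have S0 : (S !=set0)%classic by exists ((a 1 - 1) / 1%:R), 0.
have Sub : has_ubound S by exists (a 1 + 1) => _ [k _ <-]; have := cut k 0; rewrite divr1.
have lo k : a k - k%:R * sup S <= 1.
  case: k => [|k]; first by rewrite /a /= mul0r subr0.
  have : (a k.+1 - 1) / k.+1%:R <= sup S by apply: ub_le_sup => //; exists k.
  by rewrite ler_pdivrMr ?ltr0Sn// mulrC => ?; lra.
have hi k : -1 <= a k - k%:R * sup S.
  case: k => [|k]; first by rewrite /a /= mul0r subr0 lerN10.
  have : sup S <= (a k.+1 + 1) / k.+1%:R by apply: ge_sup => // _ [j _ <-].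
  by rewrite ler_pdivlMr ?ltr0Sn// mulrC => ?; lra.
suff -> : rot f = sup S by rewrite ler_norml hi lo.
apply: cvg_lim => //; apply/cvgrPdist_le => e e0; near=> k.
have k0 : 0 < k%:R :> R by rewrite ltr0n; near: k; exists 1%N.
rewrite subr0 lh_expE -/(a k) -[X in `|X|](mulKf (lt0r_neq0 k0)).
rewrite mulrBr mulrCA divff ?lt0r_neq0// mulr1 normrM gtr0_norm ?invr_gt0//.
rewrite ler_pdivrMl// distrC; apply: (@le_trans _ _ 1); first by rewrite ler_norml hi lo.
rewrite -ler_pdivrMr//.
by near: k; exact: nbhs_infty_ger.
Unshelve. all: by end_near. Qed.

Lemma rot_iter_bound f n x : `|iter n f x - x - n%:R * rot f| <= 2.
Proof.
have := rot_bound f n; have := iter_disp f n x.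
rewrite !ler_norml => /andP[? ?] /andP[? ?]; apply/andP; split; lra.
Qed.

Lemma bounded_nat_mul_le0 (u c : R) : (forall n, n%:R * u <= c) -> u <= 0.
Proof.
move=> H; rewrite leNgt; apply/negP => u0.
have c0 : 0 <= c by have := H 0%N; rewrite mul0r.
have := archi_boundP (divr_ge0 c0 (ltW u0)); rewrite ltr_pdivrMr//.
by move=> /lt_le_trans/(_ (H _)); rewrite ltxx.
Qed.

(** Repeating the inequality [k] times gives [k (n rot f - z) <= 2] for every [k], and a quantity
    with bounded multiples is at most 0. *)
Lemma rot_le f n x z : (0 < n)%N -> iter n f x <= x + z%:~R ->
  rot f <= z%:~R / n%:R.
Proof.
move=> n0 fx; rewrite ler_pdivlMr ?ltr0n// -subr_le0.
apply: (@bounded_nat_mul_le0 _ 2%R) => k.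
have := rot_iter_bound f (k * n) x; rewrite ler_norml natrM => /andP[h _].
have := iter_shift_le k fx => ?; nra.
Qed.

Lemma rot_ge f n x z : (0 < n)%N -> x + z%:~R <= iter n f x ->
  z%:~R / n%:R <= rot f.
Proof.
move=> n0 fx; rewrite ler_pdivrMr ?ltr0n// -subr_le0.
apply: (@bounded_nat_mul_le0 _ 2%R) => k.
have := rot_iter_bound f (k * n) x; rewrite ler_norml natrM => /andP[_ h].
have := iter_shift_ge k fx => ?; nra.
Qed.

Lemma rot_eq f n x z : (0 < n)%N -> iter n f x = x + z%:~R -> rot f = z%:~R / n%:R.
Proof.
by move=> n0 fx; apply/le_anti; rewrite (rot_le n0 (x := x)) ?(rot_ge n0 (x := x)) ?fx.
Qed.
End LiftHomeo.

(** * Periodic orbits of lifts with rational rotation number *)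

Section Orbits.
Variable R : realType.
Implicit Types (f g h : lift_homeo R) (x y : R) (n m : nat) (z : int).

Definition translation (c : R) : lift_homeo R.
Proof.
refine (@LiftHomeo R (fun x => x + c) (fun x => x - c) _ _ _ _ _ _).
- by move=> x; rewrite addrK.
- by move=> x; rewrite subrK.
- by move=> x; apply: cvgD; [exact: cvg_id | exact: cvg_cst].
- by move=> x; apply: cvgB; [exact: cvg_id | exact: cvg_cst].
- by move=> x y xy; rewrite ltrD2r.
- by move=> x; rewrite addrAC.
Defined.

Lemma rot_translation (c : R) : rot (translation c) = c.
Proof.
apply: cvg_lim => //; apply/cvgrPdist_le => e e0; near=> k.
have k0 : (0 < k)%N by near: k; exists 1%N.
have iterE n : iter n (translation c) 0 = n%:R * c.
  by elim: n => [|n /= ->]; rewrite ?mul0r// -natr1 mulrDl mul1r.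
by rewrite lh_expE subr0 iterE mulrC mulKf ?pnatr_eq0 -?lt0n// subrr normr0 ltW.
Unshelve. all: by end_near. Qed.

(** The orbit is nondecreasing and its supremum is fixed: if [f] moved the supremum right, an
    iterate beyond the preimage of the supremum would have its successor beyond the supremum. *)
Lemma iter_sup_fixed f x B : x <= f x -> (forall k, iter k f x <= B) ->
  exists l, [/\ f l = l, l <= B, forall k, iter k f x <= l &
    forall e, 0 < e -> exists k, l - e < iter k f x].
Proof.
move=> xf fB; pose S := [set iter k f x | k in [set: nat]]%classic.
have supS : has_sup S.
  by split; [exists x, 0%N | exists B => _ [k _ <-]].
have ubS k : iter k f x <= sup S by apply: ub_le_sup; [case: supS | exists k].
have adS e : 0 < e -> exists k, sup S - e < iter k f x.
  by move=> e0; have [_ [k _ <-] ?] := sup_adherent e0 supS; exists k.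
exists (sup S); split => //; last by apply: ge_sup; [case: supS | move=> _ [k _ <-]].
apply/le_anti/andP; split.
  rewrite leNgt; apply/negP => fS.
  have [k] : exists k, lh_inv f (sup S) < iter k f x.
    have [|k] := adS (sup S - lh_inv f (sup S)); last by rewrite subKr; exists k.
    by rewrite subr_gt0 -(lh_lt f) lh_invK.
  by rewrite -(lh_lt f) lh_invK => /lt_le_trans/(_ (ubS k.+1)); rewrite ltxx.
apply: ge_sup; first by case: supS.
move=> _ [k _ <-]; apply: (@le_trans _ _ (iter k.+1 f x)); last by rewrite /= lh_le ubS.
by rewrite iterSr iter_lh_le.
Qed.

(** If [f] moves [x] to the left, its inverse moves [x] to the right and inherits the bound, so one
    of the two has a bounded nondecreasing orbit. *)
Lemma bounded_iter_fixed f x c : (forall k y, `|iter k f y - y| <= c) ->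
  exists l, f l = l.
Proof.
move=> fc; have [xf|/ltW fx] := leP x (f x).
  have [|l []] := @iter_sup_fixed f x (x + c) xf; last by exists l.
  by move=> k; have := fc k x; rewrite ler_norml => /andP[? ?]; lra.
have xV : x <= (f^-1)%g x by rewrite -(lh_le f) lh_VE lh_invK.
have [|l [fl _ _ _]] := @iter_sup_fixed _ x (x + c) xV; last first.
  by exists l; rewrite -{1}fl lh_VE lh_invK.
move=> k; have := fc k (iter k (f^-1)%g x).
have -> : iter k f (iter k (f^-1)%g x) = x.
  by elim: k => // k IH; rewrite iterSr iterS lh_VE lh_invK.
by rewrite ler_norml => /andP[? ?]; lra.
Qed.

(** Following [f ^+ n] by the translation by [- z] cancels the drift: all iterates of the result
    displace points by at most 2, which yields a fixed point. *)
Lemma periodic_point f n z : (0 < n)%N -> rot f = z%:~R / n%:R ->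
  exists x, iter n f x = x + z%:~R.
Proof.
move=> n0 fr; pose h := (translation (- z%:~R) * f ^+ n)%g.
have hE k y : iter k h y = iter (k * n) f y - k%:R * z%:~R.
  elim: k => [|k IH]; first by rewrite mul0r subr0.
  rewrite iterS IH lh_mulE /= lh_expE mulSn iterD.
  have -> : k%:R * z%:~R = (k%:Z * z)%:~R :> R by rewrite intrM.
  by rewrite -[- (k%:Z * z)%:~R]mulrNz iter_addz mulrNz intrM -natr1; ring.
have [|l] := @bounded_iter_fixed h 0 2.
  move=> k y; rewrite hE; have := rot_iter_bound f (k * n) y.
  rewrite fr natrM -mulrA [n%:R * _]mulrC divfK ?pnatr_eq0 -?lt0n//.
  by rewrite addrAC.
by rewrite -[h l]/(iter 1 h l) hE mul1n mul1r => hl; exists l; rewrite -{2}hl subrK.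
Qed.

(* [p] and [q] being coprime, [f^i + j] on the orbit depends only on the
   combinatorial index [i p + j q]. *)
Lemma periodic_orbit_enum f x (p : int) (q : nat) : (0 < q)%N -> coprimez p q ->
  iter q f x = x + p%:~R ->
  exists X : int -> R, [/\ forall i, X i < X (i + 1),
    forall i, X (i + q%:Z) = X i + 1 & forall i, f (X i) = X (i + p)].
Proof.
move=> q0 pq fx.
pose E (i : nat) (j : int) := iter i f x + j%:~R.
have Ep i j t : E (i + t * q)%N j = E i (j + t%:Z * p).
  have -> : E (i + t * q)%N j = iter i f (iter (t * q) f x) + j%:~R by rewrite /E iterD.
  have -> : iter (t * q) f x = x + (t%:Z * p)%:~R.
    rewrite intrM; apply/le_anti.
    by rewrite (iter_shift_le t (z := p)) ?(iter_shift_ge t (z := p)) ?fx.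
  by rewrite iter_addz /E intrD -!addrA [_%:~R + _]addrC.
have q0' : q%:Z != 0 by rewrite eqz_nat -lt0n.
(* By coprimality [i' - i] is a multiple [t * q], and [t * q] steps of [f] along the orbit amount to
   a translation by [t * p]. *)
have EE i j i' j' : i%:Z * p + j * q%:Z = i'%:Z * p + j' * q%:Z -> E i j = E i' j'.
  wlog ii' : i j i' j' / (i <= i')%N.
    move=> H e; have [ii'|/ltnW ii'] := leqP i i'; first exact: H.
    by apply/esym/H.
  move=> e; have e1 : (i' - i)%N%:Z * p = (j - j') * q%:Z by rewrite -subzn// mulrBl; lia.
  have : (q%:Z %| (i' - i)%N%:Z * p)%Z by rewrite e1 dvdz_mull.
  rewrite Gauss_dvdzl 1?coprimez_sym// dvdzE !absz_nat => /dvdnP[t et].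
  have ei : i' = (i + t * q)%N by rewrite -et subnKC.
  rewrite ei Ep; congr E; apply: (mulIf q0').
  by move: e1; rewrite et PoszM mulrDl; lia.
(* The Bezout coefficient of [p] is reduced modulo [q] to be usable as an exponent of [f]; the
   quotient is moved into the other coefficient. *)
have [u [v uv]] : exists (u : nat) (v : int), u%:Z * p + v * q%:Z = 1.
  have [u [v uv]] := Bezoutz p q%:Z.
  exists `|(u %% q%:Z)%Z|%N, (v + (u %/ q%:Z)%Z * p).
  rewrite gez0_abs ?modz_ge0//; move: pq; rewrite /coprimez => /eqP <-.
  by rewrite -uv {3}(divz_eq u q%:Z); ring.
have rep k : exists ij : nat * int, ij.1%:Z * p + ij.2 * q%:Z = k.
  exists (`|((k * u%:Z) %% q%:Z)%Z|%N, k * v + ((k * u%:Z) %/ q%:Z)%Z * p) => /=.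
  rewrite gez0_abs ?modz_ge0//.
  rewrite -[RHS]mulr1 -uv mulrDr [k * (u%:Z * p)]mulrA {3}(divz_eq (k * u%:Z) q%:Z).
  by ring.
have /choice[c cE] := rep.
pose X k := E (c k).1 (c k).2.
have XE k i j : i%:Z * p + j * q%:Z = k -> X k = E i j by move=> <-; apply/EE/cE.
(* [g] raises the index by [u p + v q = 1]: it is the successor map of the enumeration. *)
pose g := (translation v%:~R * f ^+ u)%g.
have gX k : g (X k) = X (k + 1).
  rewrite (XE (k + 1) (u + (c k).1)%N ((c k).2 + v)); last first.
    by rewrite -uv -{3}(cE k) PoszD; ring.
  by rewrite /g lh_mulE /= lh_expE /X /E iter_addz -iterD intrD addrA.
have X1 k : X (k + q%:Z) = X k + 1.
  rewrite (XE _ (c k).1 ((c k).2 + 1)); first by rewrite /X /E intrD addrA.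
  by rewrite -{3}(cE k); ring.
exists X; split=> // [k|k].
  (* If [g] did not move [X k] to the right, neither would [q] applications of it, yet these add
     1. *)
  rewrite ltNge -gX; apply/negP => gk.
  have gn n : X (k + n%:Z) <= X k.
    elim: n => [|n IH]; first by rewrite addr0.
    by rewrite -addn1 PoszD addrA -gX; apply: le_trans gk; rewrite lh_le.
  by have := gn q; rewrite X1; lra.
rewrite (XE (k + p) (c k).1.+1 (c k).2); first by rewrite /X /E lh_addz.
by rewrite -{3}(cE k) -addn1 PoszD; ring.
Qed.

Lemma rational_rot_orbit f (p : rat) : rot f = ratr p ->
  exists X : int -> R, [/\ forall i, X i < X (i + 1),
    forall i, X (i + denq p) = X i + 1 & forall i, f (X i) = X (i + numq p)].
Proof.
have dE : denq p = `|denq p|%N by rewrite gez0_abs.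
have d0 : (0 < `|denq p|)%N by rewrite absz_gt0.
move=> fp; have [|x fx] := @periodic_point f `|denq p|%N (numq p) d0.
  by rewrite fp /ratr pmulrn -dE.
have [|X [X0 X1 X2]] := periodic_orbit_enum d0 _ fx.
  by rewrite -dE /coprimez /gcdz; have := coprime_num_den p.
by exists X; split=> // i; rewrite [in LHS]dE X1.
Qed.
End Orbits.

(** * Lifts obtained from increasing surjections *)

(** The preimages of [f x - e] and [f x + e] bracket a neighbourhood of [x]. *)
Lemma incr_surj_continuous (R : realType) (f g : R -> R) :
  {mono f : x y / x < y} -> cancel g f -> continuous f.
Proof.
move=> fi gK x; apply/cvgrPdist_le => e e0.
have lo : g (f x - e) < x by rewrite -fi gK; lra.
have hi : x < g (f x + e) by rewrite -fi gK; lra.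
near=> t; rewrite ler_norml; apply/andP; split.
  suff : f t < f x + e by lra.
  by rewrite -[ltRHS]gK fi; near: t; exact: lt_nbhsl.
suff : f x - e < f t by lra.
by rewrite -[ltLHS]gK fi; near: t; exact: lt_nbhsr.
Unshelve. all: by end_near. Qed.

Lemma lift_homeo_of_surj (R : realType) (f : R -> R) :
  {homo f : x y / x < y} -> (forall v, exists x, f x = v) ->
  (forall x, f (x + 1) = f x + 1) -> exists F : lift_homeo R, F =1 f.
Proof.
move=> fh /choice[g gK] fp; have fi : {mono f : x y / x < y} := leW_mono (le_mono fh).
have fK : cancel f g.
  by move=> x; apply: (inc_inj (le_mono fh)); rewrite gK.
have gi : {mono g : x y / x < y} by move=> x y; rewrite -fi !gK.
by exists (LiftHomeo fK gK (incr_surj_continuous fi gK) (incr_surj_continuous gi fK) fh fp).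
Qed.

(** * Ladders: increasing sequences of rungs [X i], periodic modulo 1 *)

Section Ladder.
Variables (R : realType) (X : int -> R) (d : int).
Hypothesis d0 : 0 < d.
Hypothesis X_incr : forall i, X i < X (i + 1).
Hypothesis X_period : forall i, X (i + d) = X i + 1.
Implicit Types (x y : R) (i j k : int).

Lemma ladder_le : {mono X : i j / i <= j}.
Proof.
apply: le_mono => i j ij.
have -> : j = i + (absz (j - i - 1)%R).+1%:Z by lia.
elim: (absz _) => [|n IH]; first exact: X_incr.
by apply: lt_trans IH _; rewrite -(addn1 n.+1) PoszD addrA.
Qed.

Lemma ladder_lt : {mono X : i j / i < j}.
Proof. exact: leW_mono ladder_le. Qed.

Lemma ladder_addz i k : X (i + k * d) = X i + k%:~R.
Proof.
elim: k => [|n IH|n IH]; first by rewrite mul0r !addr0.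
  by rewrite -addn1 PoszD mulrDl mul1r addrA X_period IH intrD addrA.
apply: (addIr 1); rewrite -X_period -addrA.
have -> : - n.+1%:Z * d + d = - n%:Z * d by rewrite -addn1 PoszD; ring.
by rewrite IH -addn1 PoszD opprD intrD !addrA subrK.
Qed.

Lemma ladder_index_exists x : exists i, X (i - 1) < x <= X i.
Proof.
pose k := Num.floor (x - X 0).
have /andP[k1 k2] := floor_itv (x - X 0).
have ex : exists n : nat, x <= X (k * d + n%:Z).
  exists `|d|%N; rewrite gez0_abs ?ltW// X_period -[k * d]add0r ladder_addz.
  by rewrite -/k intrD in k2; lra.
case: (ex_minnP ex) => [[|n] nx nmin].
  exists (k * d); move: nx; rewrite addr0 => ->; rewrite andbT.
  apply: (@lt_le_trans _ _ (X (k * d))); first by rewrite ladder_lt; lia.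
  by rewrite -[k * d]add0r ladder_addz -/k; lra.
exists (k * d + n.+1); rewrite nx andbT ltNge; apply/negP => xn.
suff /nmin : x <= X (k * d + n%:Z) by rewrite ltnn.
by move: xn; rewrite -addn1 PoszD addrA addrK.
Qed.

Definition ladder_index x : int := sval (cid (ladder_index_exists x)).

Lemma ladder_indexP x : X (ladder_index x - 1) < x <= X (ladder_index x).
Proof. by rewrite /ladder_index; case: cid. Qed.

Lemma ladder_index_uniq x i : X (i - 1) < x <= X i -> ladder_index x = i.
Proof.
move=> /andP[xi1 xi2]; have /andP[xj1 xj2] := ladder_indexP x.
have := lt_le_trans xi1 xj2; have := lt_le_trans xj1 xi2.
by rewrite !ladder_lt; lia.
Qed.

Lemma ladder_index_addz x k : ladder_index (x + k%:~R) = ladder_index x + k * d.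
Proof.
apply: ladder_index_uniq; have /andP[x1 x2] := ladder_indexP x.
by rewrite addrAC !ladder_addz ltrD2r lerD2r x1.
Qed.

Lemma ladder_index_le x y : x <= y -> ladder_index x <= ladder_index y.
Proof.
move=> xy; have /andP[x1 _] := ladder_indexP x; have /andP[_ y2] := ladder_indexP y.
by have := lt_le_trans x1 (le_trans xy y2); rewrite ladder_lt; lia.
Qed.

(** The step function [A] that replaces [rho(a)]: it jumps only at rungs and is constant up to and
    including each rung from the left. *)
Definition ladder_step (p : int) x := X (ladder_index x + p).

Lemma ladder_step_le p : {homo ladder_step p : x y / x <= y}.
Proof. by move=> x y xy; rewrite ladder_le lerD2r ladder_index_le. Qed.

Lemma ladder_step_addz p x k : ladder_step p (x + k%:~R) = ladder_step p x + k%:~R.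
Proof. by rewrite /ladder_step ladder_index_addz addrAC ladder_addz. Qed.

Lemma le_ladder_step (f : lift_homeo R) p : (forall i, f (X i) = X (i + p)) ->
  forall x, f x <= ladder_step p x.
Proof.
by move=> fX x; rewrite /ladder_step -fX lh_le; have /andP[] := ladder_indexP x.
Qed.

(** The distance to the nearest rung, a 1-Lipschitz function vanishing exactly on the rungs. *)
Definition ladder_dist x :=
  Num.min (x - X (ladder_index x - 1)) (X (ladder_index x) - x).

Lemma ladder_dist_le x j : ladder_dist x <= `|x - X j|.
Proof.
have /andP[x1 x2] := ladder_indexP x; rewrite /ladder_dist ge_min.
have [ij|ij] := leP (ladder_index x) j.
  by apply/orP; right; rewrite distrC; apply: le_trans (ler_norm _); rewrite lerD2r ladder_le.
apply/orP; left; apply: le_trans (ler_norm _); rewrite lerD2l lerN2 ladder_le; lia.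
Qed.

Lemma ladder_dist_attained x : exists j, ladder_dist x = `|x - X j|.
Proof.
have /andP[x1 x2] := ladder_indexP x; rewrite /ladder_dist; case: leP => _.
  by exists (ladder_index x - 1); rewrite gtr0_norm ?subr_gt0.
by exists (ladder_index x); rewrite distrC ger0_norm ?subr_ge0.
Qed.

Lemma ladder_dist_ge0 x : 0 <= ladder_dist x.
Proof. by have [j ->] := ladder_dist_attained x. Qed.

Lemma ladder_dist_lipschitz x y : ladder_dist x <= ladder_dist y + `|x - y|.
Proof.
have [j ->] := ladder_dist_attained y; apply: le_trans (ladder_dist_le x j) _.
by rewrite [leRHS]addrC ler_distD.
Qed.

Lemma ladder_dist_le1 x : ladder_dist x <= 1.
Proof.
have /andP[x1 x2] := ladder_indexP x.
have : X (ladder_index x) <= X (ladder_index x - 1 + d) by rewrite ladder_le; lia.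
by rewrite X_period /ladder_dist ge_min => ?; apply/orP; left; lra.
Qed.

Lemma ladder_dist_period x : ladder_dist (x + 1) = ladder_dist x.
Proof.
rewrite /ladder_dist -[1]/(1%:~R) ladder_index_addz [_ + 1 * d - 1]addrAC !ladder_addz.
by congr Num.min; ring.
Qed.

(** Halving the distance makes the perturbation 1/2-Lipschitz, so adding it to the identity keeps
    the map strictly increasing. *)
Lemma ladder_push_exists : exists phi : lift_homeo R,
  forall x, phi x = x + ladder_dist x / 2.
Proof.
apply: lift_homeo_of_surj.
- move=> x y xy; have := ladder_dist_lipschitz x y.
  by rewrite ltr0_norm ?subr_lt0// => ?; lra.
- move=> v; pose f x := x + ladder_dist x / 2.
  have fc : continuous f.
    move=> x; apply/cvgrPdist_le => e e0; near=> t.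
    have xt : `|x - t| <= e / 2.
      near: t; apply: cvgr_dist_le; [exact: cvg_id | lra].
    have := ladder_dist_lipschitz x t; have := ladder_dist_lipschitz t x.
    rewrite [`|t - x|]distrC => dtx dxt; move: (xt).
    by rewrite !ler_norml /f => /andP[? ?]; apply/andP; split; lra.
  (* The distance lies between 0 and 1, so [f (v - 1) < v <= f v]. *)
  have [|||c _ <-] := @IVT R f (v - 1) v v; last by exists c.
  - by lra.
  - exact: continuous_subspaceT.
  have d1 := ladder_dist_le1 (v - 1); have := ladder_dist_ge0 v.
  by rewrite ge_min le_max /f => ?; apply/andP; split; apply/orP; [left|right]; lra.
- by move=> x; rewrite ladder_dist_period addrAC.
Unshelve. all: by end_near. Qed.

(** The orbit of [x] increases and cannot cross the fixed rung [X i]; its limit is a fixed point,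
    hence a rung above [X (i - 1)], hence [X i]. *)
Lemma ladder_push_to_rung (phi : lift_homeo R) i x e :
  (forall y, phi y = y + ladder_dist y / 2) -> X (i - 1) < x <= X i -> 0 < e ->
  exists N, forall n, (N <= n)%N -> X i - e <= iter n phi x.
Proof.
move=> phiE /andP[xi1 xi2] e0.
have phi_ge y : y <= phi y by rewrite phiE; have := ladder_dist_ge0 y; lra.
have phiX j : phi (X j) = X j.
  rewrite phiE; have := ladder_dist_le (X j) j; have := ladder_dist_ge0 (X j).
  by rewrite subrr normr0; lra.
have iterX (k : nat) : iter k phi (X i) = X i by elim: k => //= k ->.
have [|l [phil lX xl ladh]] := @iter_sup_fixed _ phi x (X i) (phi_ge x).
  by move=> k; rewrite -[leRHS](iterX k) iter_lh_le.
have lE : l = X i.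
  have [j lj] := ladder_dist_attained l.
  have : ladder_dist l = 0 by rewrite phiE in phil; lra.
  rewrite lj => /normr0_eq0/eqP; rewrite subr_eq0 => /eqP lXj.
  have := lt_le_trans xi1 (xl 0%N); move: lX; rewrite lXj ladder_le ladder_lt => ? ?.
  by congr X; lia.
have [N /ltW lN] := ladh e e0; exists N => n Nn; rewrite -lE; apply: le_trans lN _.
rewrite -(subnK Nn) iterD; elim: (n - N)%N => //= k IH.
exact: le_trans IH (phi_ge _).
Qed.
End Ladder.

(** * Evaluation of words and the universal property of the free group *)

Section WordEval.
Local Open Scope group_scope.
Variable G : groupType.
Implicit Types (f g : G) (s t : seq letter) (l : letter).

Definition letter_eval f g l : G :=
  if l.1 then (if l.2 then g^-1 else g) else (if l.2 then f^-1 else f).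

Definition word_eval f g s : G := foldr (fun l h => letter_eval f g l * h) 1 s.

Lemma letter_eval_inv f g l : letter_eval f g (letter_inv l) = (letter_eval f g l)^-1.
Proof. by case: l => [[] []]; rewrite /letter_eval /= ?invgK. Qed.

Lemma word_eval_push f g l s :
  word_eval f g (push l s) = letter_eval f g l * word_eval f g s.
Proof.
case: s => [|y s] //=; case: eqP => [->|//] /=.
by rewrite letter_eval_inv mulVKg.
Qed.

Lemma word_eval_mul f g s t :
  word_eval f g (foldr push t s) = word_eval f g s * word_eval f g t.
Proof. by elim: s => [|l s IH] /=; rewrite ?mul1g// word_eval_push IH mulgA. Qed.

(** Existence in the universal property: the generators may be sent to any two elements. *)
Definition free2_hom f g (u : free2) : G := word_eval f g (word u).

Lemma free2_hom_mul f g : {morph free2_hom f g : u v / u * v}.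
Proof. by move=> u v; rewrite /free2_hom -word_eval_mul -free2_mulE. Qed.

HB.instance Definition _ f g :=
  isMultiplicative.Build free2 G (free2_hom f g) (@free2_hom_mul f g).

Lemma multiplicative1 (rho : {multiplicative free2 -> G}) : rho 1 = 1.
Proof. by apply: (mulgI (rho 1)); rewrite -gmulfM !mulg1. Qed.

(** Uniqueness in the universal property, by splitting off the first letter of a reduced word. *)
Lemma multiplicative_word (rho : {multiplicative free2 -> G}) (w : free2) :
  rho w = word_eval (rho fa) (rho fb) (word w).
Proof.
have letterE l : rho (@Free2 [:: l] isT) = letter_eval (rho fa) (rho fb) l.
  have rhoV (u v : free2) : u * v = 1 -> rho v = (rho u)^-1.
    by move=> uv; apply: (mulgI (rho u)); rewrite -gmulfM uv multiplicative1 mulgV.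
  case: l => [[] []]; rewrite /letter_eval /=; try (apply: rhoV; exact: val_inj);
    by congr (rho _); exact: val_inj.
case: w => s rs; elim: s rs => [|l s IH] rs /=.
  by rewrite -(multiplicative1 rho); congr (rho _); exact: val_inj.
have rs' : reduced s by case: s rs {IH} => //= y s /andP[].
have -> : Free2 rs = @Free2 [:: l] isT * Free2 rs'.
  apply: val_inj => /=; rewrite -[RHS]/(reduce (l :: s)).
  by rewrite reduce_id.
by rewrite gmulfM letterE IH.
Qed.
End WordEval.

(** * Approximation from below with the argument shifted to the left *)

Section LeftApproximation.
Variable R : realType.
Implicit Types (f : nat -> R -> R) (g : R -> R).

(** Pointwise convergence need not survive composition when [g] jumps. A lower bound that tolerates
    a small shift of the argument to the left does compose. *)
Definition left_approx f g := forall x e, 0 < e ->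
  exists2 d, 0 < d & exists N, forall n, (N <= n)%N -> g x - e <= f n (x - d).

(* Here [d] does not depend on [e]: [g] is constant just to the left of [x]. *)
Definition left_approx_flat f g := forall x,
  exists2 d, 0 < d & forall e, 0 < e ->
    exists N, forall n, (N <= n)%N -> g x - e <= f n (x - d).

Lemma left_approx_flatW f g : left_approx_flat f g -> left_approx f g.
Proof. by move=> fg x e e0; have [d d0 /(_ e e0)] := fg x; exists d. Qed.

Lemma left_approx_comp f g f' g' : (forall n, {homo f n : x y / x <= y}) ->
  left_approx f g -> left_approx f' g' ->
  left_approx (fun n => f n \o f' n) (g \o g').
Proof.
move=> fh fg fg' x e e0; have [d d0 [N1 N1P]] := fg (g' x) e e0.
have [d' d'0 [N2 N2P]] := fg' x d d0; exists d' => //; exists (maxn N1 N2) => n.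
rewrite geq_max => /andP[/N1P h1 /N2P h2].
by apply: le_trans h1 _; exact: fh.
Qed.

(** The outer map only dictates the accuracy asked of the inner one, whose offset [d'] is chosen
    before any accuracy. *)
Lemma left_approx_flat_compl f g f' g' : (forall n, {homo f n : x y / x <= y}) ->
  left_approx f g -> left_approx_flat f' g' ->
  left_approx_flat (fun n => f n \o f' n) (g \o g').
Proof.
move=> fh fg fg' x; have [d' d'0 dP'] := fg' x; exists d' => // e e0.
have [d d0 [N1 N1P]] := fg (g' x) e e0; have [N2 N2P] := dP' d d0.
exists (maxn N1 N2) => n; rewrite geq_max => /andP[/N1P h1 /N2P h2].
by apply: le_trans h1 _; exact: fh.
Qed.

(** The outer offset [d] is fixed before [e] and becomes the accuracy asked of the inner map, so the
    inner offset does not depend on [e] either. *)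
Lemma left_approx_flat_compr f g f' g' : (forall n, {homo f n : x y / x <= y}) ->
  left_approx_flat f g -> left_approx f' g' ->
  left_approx_flat (fun n => f n \o f' n) (g \o g').
Proof.
move=> fh fg fg' x; have [d d0 dP] := fg (g' x).
have [d' d'0 [N2 N2P]] := fg' x d d0; exists d' => // e e0; have [N1 N1P] := dP e e0.
exists (maxn N1 N2) => n; rewrite geq_max => /andP[/N1P h1 /N2P h2].
by apply: le_trans h1 _; exact: fh.
Qed.

Lemma left_approx_flat_iter f g k : (forall n, {homo f n : x y / x <= y}) ->
  left_approx_flat f g ->
  left_approx_flat (fun n => iter k.+1 (f n)) (iter k.+1 g).
Proof.
move=> fh fg; elim: k => [|k IH] //.
exact: left_approx_flat_compl fh (left_approx_flatW fg) IH.
Qed.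

(** The offset is chosen so that [h] takes exactly the value [h x - e] at the shifted point. *)
Lemma left_approx_lh (h : lift_homeo R) : left_approx (fun=> h) h.
Proof.
move=> x e e0; exists (x - lh_inv h (h x - e)); last first.
  by exists 0%N => n _; rewrite subKr lh_invK.
by rewrite subr_gt0 -(lh_lt h) lh_invK; lra.
Qed.

Lemma left_approx_word (F : nat -> letter -> R -> R) (g : letter -> R -> R)
    (s : seq letter) :
  (forall n l, {homo F n l : x y / x <= y}) ->
  {in s, forall l, left_approx (fun n => F n l) (g l)} ->
  left_approx (fun n x => foldr (F n) x s) (fun x => foldr g x s).
Proof.
move=> Fh; elim: s => [_|l s IH Fg].
  by move=> x e e0; exists e => //; exists 0%N.
apply: (left_approx_comp (f := fun n => F n l) (f' := fun n x => foldr (F n) x s)).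
- by move=> n; exact: Fh.
- by apply: Fg; rewrite inE eqxx.
- by apply: IH => k ks; apply: Fg; rewrite inE ks orbT.
Qed.

Lemma left_approx_flat_word (F : nat -> letter -> R -> R) (g : letter -> R -> R)
    (s : seq letter) (a : letter) :
  (forall n l, {homo F n l : x y / x <= y}) ->
  {in s, forall l, left_approx (fun n => F n l) (g l)} ->
  a \in s -> left_approx_flat (fun n => F n a) (g a) ->
  left_approx_flat (fun n x => foldr (F n) x s) (fun x => foldr g x s).
Proof.
move=> Fh; elim: s => [//|l s IH Fg]; rewrite inE => las aflat.
have Fs : {in s, forall l, left_approx (fun n => F n l) (g l)}.
  by move=> k ks; apply: Fg; rewrite inE ks orbT.
have [la|la] := eqVneq a l.
  apply: (left_approx_flat_compr (f := fun n => F n l) (f' := fun n x => foldr (F n) x s)).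
  - by move=> n; exact: Fh.
  - by rewrite -la.
  - exact: left_approx_word.
apply: (left_approx_flat_compl (f := fun n => F n l) (f' := fun n x => foldr (F n) x s)).
- by move=> n; exact: Fh.
- by apply: Fg; rewrite inE eqxx.
- by apply: IH => //; case/orP: las la => // /eqP ->; rewrite eqxx.
Qed.
End LeftApproximation.

(** * Words with the step function in place of [a] *)

(** Two of the [d + 1] terms [c 0, ..., c d] agree modulo [d]. *)
Lemma pigeonhole_mod (c : nat -> int) (d : int) : 0 < d ->
  exists j n t, [/\ (0 < n)%N, n%:Z <= d & c (j + n)%N = c j + t * d].
Proof.
move=> d0; have m0 := modz_ge0 _ (lt0r_neq0 d0).
have lt_mod k : (`|(c k %% d)%Z| < `|d|)%N.
  by have := ltz_pmod (c k) d0; have := m0 (c k); lia.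
pose r (i : 'I_(`|d|.+1)%N) : 'I_(`|d|)%N := Ordinal (lt_mod i).
have /injectivePn[i [j ij rij]] : ~~ injectiveb r.
  by apply/negP => /injectiveP/leq_card; rewrite !card_ord ltnn.
wlog lt_ij : i j ij rij / (i < j)%N.
  move=> H; have [h|h|/val_inj e] := ltngtP i j; first exact: H ij rij h.
    by apply: H (esym rij) h; rewrite eq_sym.
  by rewrite e eqxx in ij.
exists i, (j - i)%N, ((c j %/ d)%Z - (c i %/ d)%Z); split.
- by rewrite subn_gt0.
- by have := ltn_ord j; lia.
rewrite subnKC ?(ltnW lt_ij)// {1}(divz_eq (c j) d) {1}(divz_eq (c i) d).
have -> : (c j %% d)%Z = (c i %% d)%Z.
  by have := congr1 val rij; rewrite /= => e; have := m0 (c i); have := m0 (c j); lia.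
by ring.
Qed.

Lemma word_evalE (R : realType) (f g : lift_homeo R) s x :
  word_eval f g s x = foldr (fun l => letter_eval f g l) x s.
Proof. by elim: s x => //= l s IH x; rewrite IH. Qed.

Lemma iter_le_dom (R : realType) (h k : R -> R) n x :
  {homo k : x y / x <= y} -> (forall y, h y <= k y) -> iter n h x <= iter n k x.
Proof.
move=> kh hk; elim: n => //= n IH.
by apply: le_trans (hk _) _; exact: kh.
Qed.

Section StepWord.
Variables (R : realType) (X : int -> R) (d : int).
Hypothesis d0 : 0 < d.
Hypothesis X_incr : forall i, X i < X (i + 1).
Hypothesis X_period : forall i, X (i + d) = X i + 1.
Variables (g : lift_homeo R) (p : int).
Implicit Types (f : lift_homeo R) (s : seq letter) (l : letter) (x y : R).

Let step := ladder_step d0 X_incr X_period p.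

(* The letter [a^-1] gets a junk value, as it does not occur. *)
Definition step_letter l : R -> R :=
  if l.1 then lh_fun (letter_eval 1%g g l) else step.

Lemma step_letter_le l : {homo step_letter l : x y / x <= y}.
Proof.
rewrite /step_letter; case: l.1; last exact: ladder_step_le.
by move=> x z; rewrite lh_le.
Qed.

Lemma step_letter_addz l x (k : int) : step_letter l (x + k%:~R) = step_letter l x + k%:~R.
Proof. by rewrite /step_letter; case: l.1; [exact: lh_addz|exact: ladder_step_addz]. Qed.

Lemma step_word_le s : {homo (fun x => foldr step_letter x s) : x y / x <= y}.
Proof. by move=> x y xy; elim: s => //= l s; exact: step_letter_le. Qed.

Lemma step_word_addz s x (k : int) :
  foldr step_letter (x + k%:~R) s = foldr step_letter x s + k%:~R.
Proof. by elim: s => //= l s ->; rewrite step_letter_addz. Qed.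

Lemma word_le_step_word f s x : (forall i, f (X i) = X (i + p)) ->
  letter_aV \notin s -> word_eval f g s x <= foldr step_letter x s.
Proof.
move=> fX; rewrite word_evalE; elim: s => //= l s IH.
rewrite inE negb_or => /andP[la /IH {}IH].
apply: (@le_trans _ _ (step_letter l (foldr (fun l => letter_eval f g l) x s))).
  case: l la => [[] []] //= _; exact: le_ladder_step.
exact: step_letter_le.
Qed.

(** Each pass through the word [u a v] meets a rung right after that [a]. There are [d] rungs modulo
    1, so two passes at most [d] apart meet the same rung up to an integer. *)
Lemma step_word_periodic s : letter_a \in s -> exists n y (t : int),
  [/\ (0 < n)%N, n%:Z <= d &
      iter n (fun x => foldr step_letter x s) y = y + t%:~R].
Proof.
move=> /splitPr[u v]; set W : R -> R := fun x => foldr step_letter x _.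
pose U x := foldr step_letter x u; pose V x := foldr step_letter x v.
have WE x : W x = U (step (V x)) by rewrite /W foldr_cat.
(* [c n] is the index of the rung met after [n] passes, starting from [X 0]. *)
pose c := fix c (n : nat) : int :=
  if n is n'.+1 then ladder_index d0 X_incr X_period (V (U (X (c n')))) + p else 0.
have Wc j n : iter n W (U (X (c j))) = U (X (c (j + n)%N)).
  by elim: n => [|n IH]; rewrite ?addn0// iterS IH WE addnS.
have [j [n [t [n0 nd cE]]]] := pigeonhole_mod c d0.
exists n, (U (X (c j))), t; split => //.
by rewrite Wc cE (ladder_addz X_period) /U step_word_addz.
Qed.

Lemma rot_ladder f : (forall i, f (X i) = X (i + p)) -> rot f = p%:~R / d%:~R.
Proof.
move=> fX; have dE : d = `|d|%N by rewrite gez0_abs// ltW.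
have iterX n : iter n f (X 0) = X (n%:Z * p).
  by elim: n => [|n IH]; rewrite ?mul0r// iterS IH fX -addn1 PoszD mulrDl mul1r.
have -> : d%:~R = `|d|%N%:R :> R by rewrite dE.
apply: (@rot_eq _ _ _ (X 0)); first by rewrite absz_gt0 lt0r_neq0.
by rewrite iterX -dE -(ladder_addz X_period) add0r mulrC.
Qed.

Lemma word_rot_attained f s : (forall i, f (X i) = X (i + p)) ->
  letter_aV \notin s -> letter_a \in s -> exists f' n (t : int),
    [/\ rot f' = rot f, (0 < n)%N, n%:Z <= d, rot (word_eval f g s) <= t%:~R / n%:R &
        rot (word_eval f' g s) = t%:~R / n%:R].
Proof.
move=> fX aV sa; have [n [y [t [n0 nd Wy]]]] := step_word_periodic sa.
set W := fun _ => _ in Wy.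
have rot_word_le f' : (forall i, f' (X i) = X (i + p)) ->
    rot (word_eval f' g s) <= t%:~R / n%:R.
  move=> f'X; apply: (@rot_le _ _ _ y) => //; rewrite -Wy.
  apply: iter_le_dom => [|x]; first exact: step_word_le.
  exact: word_le_step_word.
have [phi phiE] := ladder_push_exists d0 X_incr X_period.
(* As [phi] fixes the rungs, [F k] acts on them like [f] and has the same rotation number. *)
pose F k := (phi ^+ k * f)%g.
have FX k i : F k (X i) = X (i + p).
  rewrite /F lh_mulE lh_expE fX; elim: k => //= k ->.
  rewrite phiE; have := ladder_dist_le d0 X_incr X_period (X (i + p)) (i + p).
  have := ladder_dist_ge0 d0 X_incr X_period (X (i + p)).
  by rewrite subrr normr0 => ? ?; lra.
pose L k l : R -> R := letter_eval (F k) g l.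
have Lh k l : {homo L k l : x y / x <= y} by move=> x z; rewrite lh_le.
have aflat : left_approx_flat (fun k => L k letter_a) (step_letter letter_a).
  move=> x; have /andP[x1 x2] := ladder_indexP d0 X_incr X_period x.
  set i := ladder_index _ _ _ _ in x1 x2.
  (* Half way to the rung below, the point [z] is still in the interval of [x]; so [f z] is in the
     interval ending at [X (i + p)], and [phi] pushes it as close to that rung as desired. *)
  exists ((x - X (i - 1)) / 2); first by lra.
  move=> e e0; set z := x - (x - X (i - 1)) / 2.
  have zi : X (i + p - 1) < f z <= X (i + p).
    rewrite addrAC -!fX lh_lt lh_le /z; apply/andP; split; lra.
  have [N NP] := ladder_push_to_rung phiE zi e0.
  by exists N => k /NP; rewrite /L /letter_eval /= lh_expE.
have Wflat : left_approx_flat (fun k x => foldr (L k) x s) W.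
  apply: (left_approx_flat_word Lh _ sa aflat) => l ls.
  case: l ls => [[] []] ls; try exact: left_approx_lh.
    by rewrite ls in aV.
  exact: left_approx_flatW aflat.
have fh k : {homo (fun x => foldr (L k) x s) : x y / x <= y}.
  by move=> x z xz; elim: (s) => //= l s' IH; exact: Lh.
(* Flatness allows the accuracy to equal the offset: the [n]-th iterate sends [y - e] to at least
   [y + t - e], an inequality about a single point that bounds the rotation number. *)
have [e e0 /(_ e e0)[N /(_ N (leqnn N))]] := left_approx_flat_iter n.-1 fh Wflat y.
rewrite prednK// Wy => Wle.
exists (F N), n, t; split => //; first by rewrite (rot_ladder fX) (rot_ladder (FX N)).
  exact: rot_word_le.
apply/le_anti/andP; split; first exact: rot_word_le.
apply: (@rot_ge _ _ _ (y - e)) => //.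
rewrite addrAC; apply: le_trans Wle _; rewrite le_eqVlt; apply/orP; left; apply/eqP.
by apply: eq_iter => x; rewrite word_evalE.
Qed.
End StepWord.

(** * Boundedness of the rotation numbers and rationality of the supremum *)

(** Each letter displaces points by at most its absolute rotation number plus 2; the displacements
    add up along the word. *)
Lemma word_rot_bounded (R : realType) (f g : lift_homeo R) s :
  rot (word_eval f g s) <= (size s)%:R * (`|rot f| + `|rot g| + 2) + 2.
Proof.
set C := `|rot f| + _ + 2.
have disp (h : lift_homeo R) x : `|rot h| + 2 <= C -> `|h x - x| <= C.
  have := rot_iter_bound h 1 x; rewrite /= mul1r => h1 h2.
  rewrite -[h x - x](subrK (rot h)); apply: le_trans (ler_normD _ _) _; lra.
have dispV (h : lift_homeo R) x : `|rot h| + 2 <= C -> `|(h^-1)%g x - x| <= C.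
  by move=> /(disp h (lh_inv h x)); rewrite lh_invK distrC.
have fC : `|rot f| + 2 <= C by rewrite /C; have := normr_ge0 (rot g); lra.
have gC : `|rot g| + 2 <= C by rewrite /C; have := normr_ge0 (rot f); lra.
have word_disp : `|word_eval f g s 0| <= (size s)%:R * C.
  elim: s => [|l s IH] /=; first by rewrite normr0 mul0r.
  set z := word_eval f g s 0 in IH *.
  have : `|letter_eval f g l z - z| <= C.
    by case: l => [[] []]; rewrite /letter_eval /=; (exact: dispV || exact: disp).
  rewrite -natr1 mulrDl mul1r; move: IH.
  by rewrite !ler_norml => /andP[? ?] /andP[? ?]; apply/andP; split; lra.
have := rot_iter_bound (word_eval f g s) 1 0; move: word_disp.
by rewrite /= mul1r subr0 !ler_norml => /andP[? ?] /andP[? ?]; lra.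
Qed.

(** The dominating fractions are multiples of [1 / q!], so one lying within [1 / q!] of the supremum
    is the largest of them. *)
Lemma sup_bounded_denominator (R : realType) (S : set R) (q : nat) : has_sup S ->
  (forall v, S v -> exists n (t : int),
    [/\ (0 < n <= q)%N, v <= t%:~R / n%:R & S (t%:~R / n%:R)]) ->
  exists n (t : int), (0 < n <= q)%N /\ sup S = t%:~R / n%:R.
Proof.
move=> supS SP; have Q0 : 0 < q`!%:R :> R by rewrite ltr0n fact_gt0.
have frac_int n (t : int) : (0 < n <= q)%N ->
    exists z : int, t%:~R / n%:R * q`!%:R = z%:~R :> R.
  move=> /andP[n0 nq]; have nQ : (n %| q`!)%N by apply: dvdn_fact; rewrite n0.
  exists (t * (q`! %/ n)%N%:Z); rewrite -{1}(divnK nQ) natrM intrM.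
  by rewrite mulrA mulrAC divfK// pnatr_eq0 -lt0n.
have Q1 : 0 < q`!%:R^-1 :> R by rewrite invr_gt0.
have [v Sv vlt] := sup_adherent Q1 supS.
have [n [t [nq vt St]]] := SP v Sv; exists n, t; split => //.
apply/le_anti; rewrite (ub_le_sup _ St) ?andbT; last by case: supS.
apply: ge_sup => [|u /SP[n' [t' [nq' ut' St']]]]; first by case: supS.
apply: le_trans ut' _.
have t's : t'%:~R / n'%:R <= sup S by apply: ub_le_sup => //; case: supS.
have [z zE] := frac_int n t nq; have [z' zE'] := frac_int n' t' nq'.
rewrite -(ler_pM2r Q0) zE zE' ler_int -ltzD1 -(ltr_int R) intrD -zE -zE'.
have : t'%:~R / n'%:R < t%:~R / n%:R + q`!%:R^-1 :> R.
  by apply: le_lt_trans t's _; rewrite -ltrBlDr; exact: lt_le_trans vlt vt.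
by move=> h; rewrite -[1%:~R](mulVf (lt0r_neq0 Q0)) -mulrDl ltr_pM2r.
Qed.

Lemma denq_frac_le (t : int) (n : nat) : (0 < n)%N -> denq (t%:~R / n%:R) <= n.
Proof.
(* The indices are generalized for the case analysis, which writes [t] and [n] as a common multiple
   of the reduced numerator and denominator. *)
move=> n0; suff gen a b x : divq_spec t n%:Z a b x -> b = n%:Z -> denq x <= n%:Z.
  exact: gen (divqP t n%:Z) erefl.
case=> [/eqP|k y k0 kn]; first by rewrite eqz_nat eqn0Ngt n0.
by have := denq_gt0 y; nia.
Qed.

Theorem theorem4p2 (R : realType) (w : free2) (r s : R) (p : rat)
  (w_semipos : semipositive w)
  (no_aV : letter_aV \notin word w)
  (has_a : word w = [::] \/ letter_a \in word w)
  (r_rat : r = ratr p) :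
  exists q : rat, max_rot w r s = ratr q /\ denq q <= denq p.
Proof.
rewrite /max_rot; set S := [set _ | _ in _]%classic.
(* By the universal property, homomorphisms amount to pairs of lifts. *)
have SE v : S v <-> exists f g, [/\ rot f = r, rot g = s & v = rot (word_eval f g (word w))].
  split=> [[rho [fr gs] <-]|[f [g [fr gs ->]]]].
    by exists (rho fa), (rho fb); rewrite -multiplicative_word.
  exists (free2_hom f g : {multiplicative free2 -> lift_homeo R}) => //=.
  by rewrite /free2_hom /= !mulg1.
have S0 : (S !=set0)%classic.
  exists (rot (word_eval (translation r) (translation s) (word w))).
  by apply/SE; exists (translation r), (translation s); rewrite !rot_translation.
(* The empty word evaluates to the identity, so the supremum is that of the singleton 0. *)
have [w0|wa] := has_a.
  exists 0; rewrite rmorph0; split; last by rewrite (denq_int 0) -gtz0_ge1 denq_gt0.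
  have S_eq0 v : S v -> v = 0.
    move=> /SE[f [g [_ _ ->]]]; rewrite w0 -[RHS](rot_translation (0 : R)).
    by congr rot; apply: lift_homeoP => x; rewrite /= addr0.
  have [v Sv] := S0; suff -> : S = [set 0]%classic by rewrite sup1.
  by apply/seteqP; split=> [u /S_eq0//|u ->]; rewrite -(S_eq0 v Sv).
have supS : has_sup S.
  split=> //; exists ((size (word w))%:R * (`|r| + `|s| + 2) + 2).
  by move=> v /SE[f [g [<- <- ->]]]; exact: word_rot_bounded.
(* The orbit of [rho(a)] has [denq p] rungs modulo 1, which is the bound on the denominators of the
   dominating values. *)
have [v /SE[f [g [fr gs ->]]]|n [t [/andP[n0 nd] ->]]] :=
    @sup_bounded_denominator _ S `|denq p|%N supS.
  have [X [X_incr X_period fX]] := rational_rot_orbit (etrans fr r_rat).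
  have [f' [n [t [f'r n0 nd le eq]]]] :=
    word_rot_attained (denq_gt0 p) X_incr X_period g fX no_aV wa.
  exists n, t; split => //; first by rewrite n0 -lez_nat gez0_abs.
  by apply/SE; exists f', g; rewrite f'r.
exists (t%:~R / n%:R); rewrite fmorph_div /= ratr_nat ratr_int; split=> //.
by apply: le_trans (denq_frac_le t n0) _; rewrite -lez_nat gez0_abs in nd.
Qed.
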